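(* Let $G$ be a finite group of order $n$. Then there exists a connected finite $T_0$ topological space $X_G$ of height $1$ such that $$\mathrm{Aut}(X_G)\cong \mathcal{E}(X_G)\cong G.$$
   Context: For a topological space $X$, $\mathrm{Aut}(X)$ denotes the group of self-homeomorphisms of $X$ under composition, and $\mathcal{E}(X)$ denotes the group of (unpointed) homotopy classes of self-homotopy equivalences of $X$ under composition. A finite $T_0$ topological space $X$ is identified with a finite poset: for $x\in X$ let $U_x$ be the intersection of all open sets containing $x$, and put $x\leq y$ if and only if $U_x\subseteq U_y$. Under this identification continuous maps are exactly the order-preserving maps. The height $\mathrm{ht}(X)$ is one less than the maximum number of elements in a chain of $X$. *)

(* Defs.v *)
From HB Require Import structures.
From mathcomp Require Import all_boot all_order all_fingroup all_algebra finmap.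
From mathcomp Require Import generic_quotient.
From mathcomp Require Import all_classical all_reals topology normedtype.
From mathcomp Require Import ring lra.

Set Implicit Arguments.
Unset Strict Implicit.
Unset Printing Implicit Defensive.

Import Order.TTheory GRing.Theory Num.Theory.
Import numFieldNormedType.Exports.
Local Open Scope classical_set_scope.

Definition group_isomorphic (G H : groupType) : Prop :=
  exists f : {multiplicative G -> H}, bijective f.

Section Height.
Variable X : topologicalType.

Definition min_open (x : X) : set X := \bigcap_(U in open_nbhs x) U.

Definition space_le (x y : X) : Prop := min_open x `<=` min_open y.

(* Meaningful when X is finite and nonempty: [fset_set] of an infinite set is
   empty, and [.-1] is truncated. *)
Definition height : nat :=
  (\max_(C <- fpowerset (fset_set [set: X]) | `[< total_on [set` C] space_le >])
     #|` C|).-1.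

End Height.

Section HomeoAut.
Variable X : topologicalType.

Definition homeomorphism (f : X -> X) : Prop :=
  continuous f /\
  exists g : X -> X, [/\ continuous g, cancel f g & cancel g f].

(* Carrier of Aut(X); the product is composition, [f * g = f \o g]. *)
Definition homeoAut : Type := set_type [set f | homeomorphism f].
HB.instance Definition _ := Choice.on homeoAut.

Definition homeoAut_fun (f : homeoAut) : X -> X := set_val f.

Lemma homeoAut_funP (f : homeoAut) : homeomorphism (homeoAut_fun f).
Proof. exact: set_valP f. Qed.

Lemma homeoAut_inj : injective homeoAut_fun.
Proof. exact: val_inj. Qed.

Definition mkhomeoAut (f : X -> X) (hf : homeomorphism f) : homeoAut :=
  exist _ f (mem_set hf).

Lemma homeomorphism_id : homeomorphism (@idfun X).
Proof.
split; first by move=> x; exact: cvg_id.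
by exists idfun; split => // x; exact: cvg_id.
Qed.

Lemma homeomorphism_comp (f g : X -> X) :
  homeomorphism f -> homeomorphism g -> homeomorphism (f \o g).
Proof.
move=> [cf [f' [cf' fK f'K]]] [cg [g' [cg' gK g'K]]]; split.
  by move=> x; apply: continuous_comp; [exact: cg | exact: cf].
exists (g' \o f'); split.
- by move=> x; apply: continuous_comp; [exact: cf' | exact: cg'].
- exact: can_comp.
- exact: can_comp.
Qed.

Lemma homeomorphism_inv (f : homeoAut) :
  exists g : homeoAut, cancel (homeoAut_fun f) (homeoAut_fun g) /\
                  cancel (homeoAut_fun g) (homeoAut_fun f).
Proof.
have [cf [g [cg fK gK]]] := homeoAut_funP f.
have hg : homeomorphism g by split => //; exists (homeoAut_fun f); split.
by exists (mkhomeoAut hg).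
Qed.

Definition homeoAut_one : homeoAut := mkhomeoAut homeomorphism_id.
Definition homeoAut_mul (f g : homeoAut) : homeoAut :=
  mkhomeoAut (homeomorphism_comp (homeoAut_funP f) (homeoAut_funP g)).
Definition homeoAut_inv (f : homeoAut) : homeoAut :=
  projT1 (cid (homeomorphism_inv f)).

Lemma homeoAut_mulA : associative homeoAut_mul.
Proof. by move=> f g h; apply: homeoAut_inj. Qed.
Lemma homeoAut_mul1l : left_id homeoAut_one homeoAut_mul.
Proof. by move=> f; apply: homeoAut_inj. Qed.
Lemma homeoAut_mul1r : right_id homeoAut_one homeoAut_mul.
Proof. by move=> f; apply: homeoAut_inj. Qed.
Lemma homeoAut_mulVl : left_inverse homeoAut_one homeoAut_inv homeoAut_mul.
Proof.
move=> f; apply: homeoAut_inj; apply/funext => x.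
by rewrite /homeoAut_inv; case: cid => g [fK gK]; exact: fK.
Qed.
Lemma homeoAut_mulVr : right_inverse homeoAut_one homeoAut_inv homeoAut_mul.
Proof.
move=> f; apply: homeoAut_inj; apply/funext => x.
by rewrite /homeoAut_inv; case: cid => g [fK gK]; exact: gK.
Qed.

HB.instance Definition _ :=
  isGroup.Build homeoAut homeoAut_mulA homeoAut_mul1l homeoAut_mul1r
    homeoAut_mulVl homeoAut_mulVr.

End HomeoAut.

Section Homotopy.
Variable R : realType.
Local Open Scope ring_scope.

Definition homotopic (X Y : topologicalType) (f g : X -> Y) : Prop :=
  exists H : X * R -> Y,
    [/\ {within [set: X] `*` `[0, 1], continuous H},
        forall x, H (x, 0) = f x & forall x, H (x, 1) = g x].

Lemma within_comp (S T U : topologicalType) (A : set S) (B : set T)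
    (phi : S -> T) (h : T -> U) :
  continuous phi -> (forall x, A x -> B (phi x)) ->
  {within B, continuous h} -> {within A, continuous (h \o phi)}.
Proof.
move=> cphi AB /subspace_continuousP ch; apply/subspace_continuousP => x Ax.
apply: cvg_comp; last exact: ch (AB _ Ax).
move=> V; rewrite /within /= => WV.
have := cphi x _ WV; rewrite !nbhs_simpl /=.
by apply: filterS => y /= BV Ay; exact: BV (AB _ Ay).
Qed.

Lemma in_segment (u v t : R) :
  (`[u, v]%classic : set R) t <-> (u <= t) && (t <= v).
Proof. by rewrite /= in_itv. Qed.

Section Relation.
Variables X Y : topologicalType.
Implicit Types f g h : X -> Y.

Lemma homotopic_refl f : continuous f -> homotopic f f.
Proof.
move=> cf; exists (f \o fst); split => //; apply: continuous_subspaceT.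
by move=> p; apply: continuous_comp; [exact: cvg_fst | exact: cf].
Qed.

Lemma continuous_reparam (phi : R -> R) :
  continuous phi -> continuous (fun p : X * R => (p.1, phi p.2)).
Proof.
move=> cphi p; apply: (@cvg_pair _ _ _ _ (nbhs p.1) (nbhs (phi p.2))).
  exact: cvg_fst.
by apply: (@cvg_comp _ _ _ snd phi _ (nbhs p.2)); [exact: cvg_snd | exact: cphi].
Qed.

Lemma homotopic_sym f g : homotopic f g -> homotopic g f.
Proof.
move=> [H [cH H0 H1]].
exists (H \o (fun p : X * R => (p.1, 1 - p.2))); split.
- apply: within_comp cH.
    by apply: (@continuous_reparam (fun t => 1 - t)) => t;
       apply: cvgB; [exact: cvg_cst | exact: cvg_id].
  move=> [x t] [_ /in_segment/andP[/= t0 t1]]; split => //.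
  by apply/in_segment/andP; split => /=; lra.
- by move=> x /=; rewrite subr0 H1.
- by move=> x /=; rewrite subrr H0.
Qed.

Lemma homotopic_trans g f h :
  homotopic f g -> homotopic g h -> homotopic f h.
Proof.
move=> [H [cH H0 H1]] [K [cK K0 K1]].
pose a (p : X * R) := (p.1, 2 * p.2); pose b (p : X * R) := (p.1, 2 * p.2 - 1).
pose L p := if p.2 <= 1/2 then H (a p) else K (b p).
have ca : continuous a.
  apply: (@continuous_reparam (fun t => 2 * t)) => t.
  by apply: cvgM; [exact: cvg_cst | exact: cvg_id].
have cb : continuous b.
  apply: (@continuous_reparam (fun t => 2 * t - 1)) => t.
  apply: cvgB; last exact: cvg_cst.
  by apply: cvgM; [exact: cvg_cst | exact: cvg_id].
exists L; split.
- have -> : [set: X] `*` `[(0:R), 1] =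
      ([set: X] `*` `[0, 1/2]) `|` ([set: X] `*` `[1/2, 1]).
    apply/seteqP; split => [[x t]|[x t]].
      move=> [_ /in_segment/andP[/= t0 t1]].
      have [t2|t2] := leP t (1/2); [left|right]; split => //.
        by apply/in_segment/andP; split.
      by apply/in_segment/andP; split => //=; exact: ltW.
    by move=> [[_ /in_segment/andP[/= t0 t1]]|[_ /in_segment/andP[/= t0 t1]]];
       split => //; apply/in_segment/andP; split => /=; lra.
  have clX (u v : R) : closed ([set: X] `*` `[u, v]).
    have -> : [set: X] `*` `[u, v] = @snd X R @^-1` `[u, v].
      by apply/seteqP; split => [[x t] []|[x t]] //=.
    apply: preimage_closed; first by move=> p _; exact: cvg_snd.
    exact: itv_closed.
  apply: withinU_continuous; [exact: clX | exact: clX | |].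
  + apply: (@subspace_eq_continuous _ _ _ (H \o a)).
      move=> [x t] /set_mem [_ /in_segment/andP[/= t0 t1]].
      by rewrite /from_subspace /L /= t1.
    apply: (within_comp ca _ cH) => -[x t] [_ /in_segment/andP[/= t0 t1]].
    by split => //; apply/in_segment/andP; split => /=; lra.
  + apply: (@subspace_eq_continuous _ _ _ (K \o b)).
      move=> [x t] /set_mem [_ /in_segment/andP[/= t0 t1]].
      rewrite /from_subspace /L /=; have [t2|//] := leP t (1/2).
      have -> : t = 1/2 by apply/eqP; rewrite eq_le t0 t2.
      rewrite /a /b /=.
      have -> : 2 * (1 / 2) = 1 :> R by field.
      by rewrite subrr K0 H1.
    apply: (within_comp cb _ cK) => -[x t] [_ /in_segment/andP[/= t0 t1]].
    by split => //; apply/in_segment/andP; split => /=; lra.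
- by move=> x; rewrite /L /a /= mulr0 ifT ?H0 //; lra.
- move=> x; rewrite /L /b /= ifF; last by apply/negbTE; rewrite -ltNge; lra.
  have -> : 2 * 1 - 1 = 1 :> R by ring.
  exact: K1.
Qed.

End Relation.

Lemma homotopic_compl (X Y Z : topologicalType) (k : Y -> Z) (f g : X -> Y) :
  continuous k -> homotopic f g -> homotopic (k \o f) (k \o g).
Proof.
move=> ck [H [cH H0 H1]]; exists (k \o H); split.
- apply/subspace_continuousP => p Ap; apply: cvg_comp; last exact: ck.
  by move/subspace_continuousP : cH; exact.
- by move=> x /=; rewrite H0.
- by move=> x /=; rewrite H1.
Qed.

Lemma homotopic_compr (X Y Z : topologicalType) (k : X -> Y) (f g : Y -> Z) :
  continuous k -> homotopic f g -> homotopic (f \o k) (g \o k).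
Proof.
move=> ck [H [cH H0 H1]].
exists (H \o (fun p : X * R => (k p.1, p.2))).
split => [|x|x] /=; rewrite ?H0 ?H1 //.
apply: within_comp cH; last by move=> [x t] [_ ?]; split.
move=> p; apply: (@cvg_pair _ _ _ _ (nbhs (k p.1)) (nbhs p.2)).
  by apply: (@cvg_comp _ _ _ fst k _ (nbhs p.1)); [exact: cvg_fst | exact: ck].
exact: cvg_snd.
Qed.

Lemma homotopic_comp (X Y Z : topologicalType) (f f' : Y -> Z) (g g' : X -> Y) :
  continuous f -> continuous g' -> homotopic f f' -> homotopic g g' ->
  homotopic (f \o g) (f' \o g').
Proof.
move=> cf cg' ff' gg'; apply: (@homotopic_trans _ _ (f \o g')).
  exact: homotopic_compl.
exact: homotopic_compr.
Qed.

End Homotopy.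

Section HEquiv.
Variables (R : realType) (X : topologicalType).

Definition homotopy_equivalence (f : X -> X) : Prop :=
  continuous f /\
  exists g : X -> X, [/\ continuous g, homotopic R (g \o f) idfun
                       & homotopic R (f \o g) idfun].

Definition hequiv : Type := set_type [set f | homotopy_equivalence f].
HB.instance Definition _ := Choice.on hequiv.

Definition hequiv_fun (f : hequiv) : X -> X := set_val f.

Lemma hequiv_funP (f : hequiv) : homotopy_equivalence (hequiv_fun f).
Proof. exact: set_valP f. Qed.

Definition mkhequiv (f : X -> X) (hf : homotopy_equivalence f) : hequiv :=
  exist _ f (mem_set hf).

Lemma hequiv_cts (f : hequiv) : continuous (hequiv_fun f).
Proof. by have [] := hequiv_funP f. Qed.

Definition hequiv_rel : rel hequiv :=
  fun f g => `[< homotopic R (hequiv_fun f) (hequiv_fun g) >].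

Lemma hequiv_rel_refl : reflexive hequiv_rel.
Proof. by move=> f; apply/asboolP; apply: homotopic_refl; exact: hequiv_cts. Qed.
Lemma hequiv_rel_sym : symmetric hequiv_rel.
Proof. by move=> f g; apply/asboolP/asboolP => /homotopic_sym. Qed.
Lemma hequiv_rel_trans : transitive hequiv_rel.
Proof.
by move=> g f h /asboolP fg /asboolP gh; apply/asboolP; exact: homotopic_trans gh.
Qed.

Canonical hequiv_equiv :=
  EquivRel hequiv_rel hequiv_rel_refl hequiv_rel_sym hequiv_rel_trans.

Local Open Scope quotient_scope.

(* Carrier of E(X): homotopies are free (unpointed), and the product is induced
   by composition, see [hequivClass_mulE]. *)
Definition hequivClass : Type := {eq_quot hequiv_rel}.
HB.instance Definition _ := Choice.on hequivClass.
HB.instance Definition _ := EqQuotient.on hequivClass.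

Lemma hequivClassP (f g : hequiv) :
  \pi_hequivClass f = \pi_hequivClass g <->
  homotopic R (hequiv_fun f) (hequiv_fun g).
Proof.
split; first by move/eqmodP => /= /asboolP.
by move=> fg; apply/eqmodP; exact/asboolP.
Qed.

Lemma homotopy_equivalence_id : homotopy_equivalence idfun.
Proof.
have cid : continuous (@idfun X) by move=> x; exact: cvg_id.
by split => //; exists idfun; split => //; exact: homotopic_refl.
Qed.

Lemma homotopy_equivalence_comp (f g : X -> X) :
  homotopy_equivalence f -> homotopy_equivalence g ->
  homotopy_equivalence (f \o g).
Proof.
have cC (u v : X -> X) : continuous u -> continuous v -> continuous (u \o v).
  by move=> cu cv x; apply: continuous_comp; [exact: cv | exact: cu].
have mid (u u' v v' : X -> X) : continuous u -> continuous u' ->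
    continuous v -> homotopic R (u' \o u) idfun ->
    homotopic R (v' \o v) idfun -> continuous v' ->
    homotopic R ((v' \o u') \o (u \o v)) idfun.
  move=> cu cu' cv hu hv cv'.
  apply: (@homotopic_trans _ _ _ (v' \o v)) => //.
  apply: (@homotopic_compl R _ _ _ v' (u' \o u \o v) v) => //.
  exact: (@homotopic_compr R _ _ _ v (u' \o u) idfun).
move=> [cf [f' [cf' hf hf']]] [cg [g' [cg' hg hg']]]; split; first exact: cC.
by exists (g' \o f'); split; [exact: cC | exact: mid | exact: mid].
Qed.

Lemma homotopy_equivalence_inv (f : hequiv) :
  exists g : hequiv,
    homotopic R (hequiv_fun g \o hequiv_fun f) idfun /\
    homotopic R (hequiv_fun f \o hequiv_fun g) idfun.
Proof.
have [cf [g [cg gf fg]]] := hequiv_funP f.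
have hg : homotopy_equivalence g by split => //; exists (hequiv_fun f); split.
by exists (mkhequiv hg).
Qed.

Definition hequiv_one : hequiv := mkhequiv homotopy_equivalence_id.
Definition hequiv_mul (f g : hequiv) : hequiv :=
  mkhequiv (homotopy_equivalence_comp (hequiv_funP f) (hequiv_funP g)).
Definition hequiv_inv (f : hequiv) : hequiv :=
  projT1 (cid (homotopy_equivalence_inv f)).

Definition hequivClass_one : hequivClass := \pi_hequivClass hequiv_one.
Definition hequivClass_mul (a b : hequivClass) : hequivClass :=
  \pi_hequivClass (hequiv_mul (repr a) (repr b)).
Definition hequivClass_inv (a : hequivClass) : hequivClass :=
  \pi_hequivClass (hequiv_inv (repr a)).

Lemma hequivClass_mulE (f g : hequiv) :
  hequivClass_mul (\pi_hequivClass f) (\pi_hequivClass g) =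
  \pi_hequivClass (hequiv_mul f g).
Proof.
have reprP (k : hequiv) :
    homotopic R (hequiv_fun (repr (\pi_hequivClass k))) (hequiv_fun k).
  by apply/hequivClassP; rewrite reprK.
by apply/hequivClassP; apply: homotopic_comp => //; exact: hequiv_cts.
Qed.

Lemma hequivClass_mulA : associative hequivClass_mul.
Proof.
elim/quotW=> f; elim/quotW=> g; elim/quotW=> h.
rewrite (hequivClass_mulE g h) (hequivClass_mulE f g) !hequivClass_mulE.
by apply/hequivClassP; apply: homotopic_refl; exact: hequiv_cts.
Qed.
Lemma hequivClass_mul1l : left_id hequivClass_one hequivClass_mul.
Proof.
elim/quotW=> f; rewrite hequivClass_mulE.
by apply/hequivClassP; apply: homotopic_refl; exact: hequiv_cts.
Qed.
Lemma hequivClass_mul1r : right_id hequivClass_one hequivClass_mul.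
Proof.
elim/quotW=> f; rewrite hequivClass_mulE.
by apply/hequivClassP; apply: homotopic_refl; exact: hequiv_cts.
Qed.
Lemma hequivClass_mulVl :
  left_inverse hequivClass_one hequivClass_inv hequivClass_mul.
Proof.
move=> a; rewrite -[X in hequivClass_mul _ X]reprK hequivClass_mulE.
by apply/hequivClassP; rewrite /hequiv_inv; case: cid => g [].
Qed.
Lemma hequivClass_mulVr :
  right_inverse hequivClass_one hequivClass_inv hequivClass_mul.
Proof.
move=> a; rewrite -[X in hequivClass_mul X _]reprK hequivClass_mulE.
by apply/hequivClassP; rewrite /hequiv_inv; case: cid => g [].
Qed.

HB.instance Definition _ :=
  isGroup.Build hequivClass hequivClass_mulA hequivClass_mul1l hequivClass_mul1r
    hequivClass_mulVl hequivClass_mulVr.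

End HEquiv.

(* Main.v *)
Require Import Defs.
From mathcomp Require Import all_boot all_fingroup.
From mathcomp Require Import all_classical all_reals topology.
From HB Require Import structures.
From mathcomp Require Import all_order all_algebra finmap.
From mathcomp Require Import normedtype zify.

(** The space is the height-one poset of a finite incidence structure: points
    are minimal, blocks are maximal, and a point lies below the blocks that
    contain it.

    Homotopy brings nothing new for such a space as soon as every point lies on
    at least two blocks and every block contains at least two points. Then a continuous self-map
    comparable with the identity is the identity ([rigid_incidence]; this is
    the absence of beat points). Along a homotopy in a finite space, the map at
    a time near [t] lies below the map at time [t], so the set of times at
    which a homotopy from the identity is the identity is open, and so is its
    complement; as the real line is connected, the homotopy is constant
    ([homotopic_id_eq], after Stong). Homotopic homeomorphisms are thus equal
    and homotopy equivalences are homeomorphisms, which gives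
    [homeoAut_iso_hequivClass].

    It remains to find an incidence structure with automorphism group [G]. Write
    [n] for the order of [G] and [v_0, ..., v_(n-1)] for its elements. The
    points are markers [0, ..., n] and two copies [a g], [b g] of [G]. The blocks
    are
    - [S_j], the markers [0, ..., j+1], for [j < n];
    - [T_(g,i)], all markers except [i+1], together with [a g] and [b (g v_i)];
    - [A], the markers and all [a g];
    - [W], all points.
    The group acts by left translation on both copies of [G], fixing the
    markers. Conversely, counting points shows that an automorphism fixes each
    [S_j] and [W]; it then fixes [A] too, which contains all markers while the
    blocks [T_(g,i)] do not. Hence it preserves the markers and both copies of [G], and in fact it fixes each
    marker ([aut_Kpt]). As [T_(g,i)] reveals [i] by the marker that it omits, an
    automorphism acting by [alpha] and [beta] on the two copies satisfies
    [beta (g v) = alpha g v] for all [g] and [v], so that both are the left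
    translation by [alpha 1] ([aut_translation]). *)

Set Implicit Arguments.
Unset Strict Implicit.
Unset Printing Implicit Defensive.

Import Order.TTheory GRing.Theory Num.Theory.
Import numFieldNormedType.Exports.

Local Open Scope classical_set_scope.

(** * Group isomorphisms *)

Lemma inj_surj_bijective (A B : Type) (f : A -> B) :
  injective f -> (forall y, exists x, f x = y) -> bijective f.
Proof.
move=> f_inj /choice[g fg]; exists g => // x.
by apply: f_inj; rewrite fg.
Qed.

Lemma group_isomorphic_bij (G H : groupType) (f : G -> H) :
  {morph f : x y / (x * y)%g} -> bijective f -> group_isomorphic G H.
Proof.
move=> fM bij_f; pose fm := isMultiplicative.Build G H f fM.
pose F : {multiplicative G -> H} := HB.pack f fm.
by exists F.
Qed.

Lemma group_isomorphic_sym (G H : groupType) :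
  group_isomorphic G H -> group_isomorphic H G.
Proof.
move=> [f [g fK gK]]; apply: (@group_isomorphic_bij _ _ g); last by exists f.
by move=> x y; apply: (can_inj fK); rewrite gK gmulfM !gK.
Qed.

Lemma group_isomorphic_trans (G H K : groupType) :
  group_isomorphic G H -> group_isomorphic H K -> group_isomorphic G K.
Proof.
move=> [f bf] [g bg]; apply: (@group_isomorphic_bij _ _ (g \o f)).
  by move=> x y; rewrite /= !gmulfM.
exact: bij_comp.
Qed.

(** * Minimal open sets of a finite space *)

Section FiniteSpace.
Variable X : topologicalType.
Hypothesis finX : finite_set [set: X].

Lemma filter_forall_finite (T : Type) (F : set_system T) (FF : Filter F)
    (Q : X -> T -> Prop) :
  (forall x, F [set t | Q x t]) -> F [set t | forall x, Q x t].
Proof.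
move=> FQ.
have := @filter_bigI T X (fset_set [set: X]) (fun x => [set t | Q x t]) F FF.
move=> /(_ (fun x _ => FQ x)); apply: filterS => t Qt x; apply: (Qt x).
by rewrite /= in_fset_set //; exact: mem_set.
Qed.

Lemma min_open_self (x : X) : min_open x x.
Proof. by move=> U [_ Ux]. Qed.

Lemma min_open_sub (x : X) (U : set X) : open U -> U x -> min_open x `<=` U.
Proof. by move=> oU Ux y; apply. Qed.

(** The points outside [min_open x] are finitely many, and each of them is
    missed by some open neighbourhood of [x]. *)
Lemma nbhs_min_open (x : X) : nbhs x (min_open x).
Proof.
have : nbhs x [set z | forall y, min_open x y \/ z <> y].
  apply: filter_forall_finite => y.
  have [xy|/existsNP[U /not_implyP[oU nUy]]] := pselect (min_open x y).
    by apply: filterS filterT => z _; left.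
  apply: filterS (open_nbhs_nbhs oU) => z Uz; right => zy.
  by apply: nUy; rewrite -zy.
by apply: filterS => z /(_ z) [].
Qed.

Lemma open_min_open (x : X) : open (min_open x).
Proof.
rewrite openE => y xy; apply: filterS (nbhs_min_open y) => z yz U oUx.
by apply: yz; split; [have [] := oUx | apply: xy].
Qed.

Lemma space_leE (x y : X) : space_le x y <-> min_open y x.
Proof.
split=> [le_xy|yx]; first exact: (le_xy x (@min_open_self x)).
exact: min_open_sub (open_min_open y) yx.
Qed.

Lemma continuous_space_le (f : X -> X) (x y : X) :
  continuous f -> space_le x y -> space_le (f x) (f y).
Proof.
move=> /continuousP cf /space_leE yx; apply/space_leE.
by apply: (min_open_sub (cf _ (open_min_open (f y))) _ yx); apply: min_open_self.
Qed.

End FiniteSpace.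

(** * Homotopies in a rigid finite space *)

(** For a finite T0 space this says that there are no beat points. *)
Definition rigid_space (X : topologicalType) : Prop :=
  forall f : X -> X, continuous f ->
  (forall x, space_le (f x) x) \/ (forall x, space_le x (f x)) -> f = idfun.

Section Rigidity.
Variables (R : realType) (X : topologicalType).
Hypothesis finX : finite_set [set: X].
Local Open Scope ring_scope.

Definition clamp (t : R) : R := Num.max 0 (Num.min 1 t).

Lemma continuous_clamp : continuous clamp.
Proof.
move=> t; apply: (@continuous_max R R (cst 0) (fun t => Num.min 1 t)).
  exact: cst_continuous.
by apply: (@continuous_min R R (cst 1) id); [exact: cst_continuous | exact: cvg_id].
Qed.

Lemma clamp_itv t : `[0%R, 1%R]%classic (clamp t).
Proof.
apply/in_segment; rewrite /clamp le_max lexx /= ge_max ler01 /=.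
by rewrite ge_min lexx.
Qed.

(** The times at which the homotopy is the identity form a clopen set. The
    homotopy is extended by clamping from the unit interval to the whole line,
    so that no boundary case arises. *)
Lemma homotopic_id_eq (g : X -> X) :
  rigid_space X -> homotopic R idfun g -> g = idfun.
Proof.
move=> rigX [H [cH H0 H1]].
pose K t x := H (x, clamp t).
have cK : continuous (fun p : X * R => K p.2 p.1).
  apply/continuous_subspace_setT.
  apply: (@within_comp _ _ _ setT _ (fun p : X * R => (p.1, clamp p.2)) H _ _ cH).
    exact/continuous_reparam/continuous_clamp.
  by move=> p _; split=> //; exact: clamp_itv.
have cKt t : continuous (K t).
  move=> x; apply: (@cvg_comp _ _ _ (fun y => (y, t)) (fun p => K p.2 p.1)
    _ (nbhs (x, t))); last exact: cK (x, t).
  by apply: (@cvg_pair _ _ _ _ (nbhs x) (nbhs t)); [exact: cvg_id | exact: cvg_cst].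
(* The minimal open set of [K t x] is a neighbourhood of it, and there are
   finitely many [x]. *)
have Knear t : \forall s \near t, forall x, space_le (K s x) (K t x).
  apply: (filter_forall_finite finX) => x.
  have : nbhs (x, t) [set p | min_open (K t x) (K p.2 p.1)].
    by apply: (cK (x, t)); exact: nbhs_min_open.
  case=> -[A B] /= [nA nB] AB; apply: filterS nB => s Bs.
  by apply/space_leE => //; apply: (AB (x, s)); split=> //; exact: nbhs_singleton.
pose E := [set t | K t = idfun].
have oE : open E.
  rewrite openE => t Et; apply: filterS (Knear t) => s Ks.
  by apply: rigX => //; left=> x; have := Ks x; rewrite Et.
(* If [K s] is the identity for some [s] near [t], then [K t] lies above it. *)
have cE : closed E.
  rewrite -[E]setCK; apply: open_closedC.
  rewrite openE => t Et; apply: filterS (Knear t) => s Ks Es; apply: Et.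
  by apply: rigX => //; right=> x; have := Ks x; rewrite Es.
have ET : E = setT.
  have /connected_intervalP conR : is_interval [set: R] by [].
  apply: conR; last 2 first.
  - by exists E => //; rewrite setTI.
  - by exists E => //; rewrite setTI.
  exists 0; apply/funext => x; rewrite /K /clamp.
  by rewrite (_ : Num.min _ _ = 0) ?maxxx //; apply/min_idPr.
have K1 : K 1 = g.
  apply/funext => x; rewrite /K /clamp.
  by rewrite minxx (_ : Num.max _ _ = 1) //; apply/max_idPr.
have : E 1 by rewrite ET.
by rewrite /E /= K1.
Qed.

Lemma homotopic_homeomorphism_eq (f g : X -> X) :
  rigid_space X -> homeomorphism f -> homotopic R f g -> f = g.
Proof.
move=> rigX [cf [f' [cf' fK f'K]]] fg.
have : f' \o g = idfun.
  apply: homotopic_id_eq => //.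
  by have := homotopic_compl cf' fg; rewrite (_ : f' \o f = idfun) //; exact/funext.
move=> /funeqP f'g; apply/funext => x; rewrite -[g x]f'K; congr f.
exact: esym (f'g x).
Qed.

Lemma homotopy_equivalence_homeomorphism (f : X -> X) :
  rigid_space X -> homotopy_equivalence R f -> homeomorphism f.
Proof.
move=> rigX [cf [g [cg gf fg]]]; split=> //; exists g; split=> //.
  by move=> x; have /funeqP/(_ x) := homotopic_id_eq rigX (homotopic_sym gf).
by move=> x; have /funeqP/(_ x) := homotopic_id_eq rigX (homotopic_sym fg).
Qed.

Lemma homeomorphism_homotopy_equivalence (f : X -> X) :
  homeomorphism f -> homotopy_equivalence R f.
Proof.
move=> [cf [g [cg fK gK]]]; split=> //; exists g; split=> //.
  rewrite (_ : g \o f = idfun); last exact/funext.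
  by apply: homotopic_refl => x; exact: cvg_id.
rewrite (_ : f \o g = idfun); last exact/funext.
by apply: homotopic_refl => x; exact: cvg_id.
Qed.

Local Open Scope quotient_scope.

Definition homeo_class (f : homeoAut X) : hequivClass R X :=
  \pi_(hequivClass R X)
    (mkhequiv (homeomorphism_homotopy_equivalence (homeoAut_funP f))).

Lemma homeo_classM : {morph homeo_class : f g / (f * g)%g}.
Proof.
move=> f g; rewrite /homeo_class [RHS]hequivClass_mulE.
by apply/hequivClassP/homotopic_refl/hequiv_cts.
Qed.

Lemma homeo_class_bij : rigid_space X -> bijective homeo_class.
Proof.
move=> rigX.
apply: inj_surj_bijective => [f g /hequivClassP|].
  move=> /(homotopic_homeomorphism_eq rigX (homeoAut_funP f)).
  exact: homeoAut_inj.
elim/quotW=> f.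
exists (mkhomeoAut (homotopy_equivalence_homeomorphism rigX (hequiv_funP f))).
by apply/hequivClassP/homotopic_refl/hequiv_cts.
Qed.

Lemma homeoAut_iso_hequivClass :
  rigid_space X -> group_isomorphic (homeoAut X) (hequivClass R X).
Proof.
move=> rigX; apply: group_isomorphic_bij homeo_classM _; exact: homeo_class_bij.
Qed.

End Rigidity.

(** * The poset of an incidence structure *)

(** A copy of the disjoint union of points and blocks, which keeps its topology
    apart from that of the sum type. *)
Definition incidence_space (P T : finType) (inc : P -> T -> bool) : Type :=
  (P + T)%type.

Section IncidenceSpace.
Variables (P T : finType) (inc : P -> T -> bool).
Local Notation X := (incidence_space inc).

HB.instance Definition _ := Choice.copy X (P + T)%type.

Definition inc_le (x y : X) : bool :=
  match x, y with
  | inl p, inr t => inc p t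
  | inl p, inl q => p == q
  | inr t, inr u => t == u
  | inr _, inl _ => false
  end.

Definition down_closed (U : set X) : Prop :=
  forall x y, inc_le x y -> U y -> U x.

Lemma down_closedT : down_closed setT. Proof. by []. Qed.

Lemma down_closedI : setI_closed down_closed.
Proof. by move=> U V dU dV x y xy [Uy Vy]; split; [exact: dU Uy | exact: dV Vy]. Qed.

Lemma down_closed_bigU (I : Type) (f : I -> set X) :
  (forall i, down_closed (f i)) -> down_closed (\bigcup_i f i).
Proof. by move=> df x y xy [i _ fy]; exists i => //; exact: df fy. Qed.

HB.instance Definition _ :=
  isOpenTopological.Build X down_closedT down_closedI down_closed_bigU.

Lemma openE_down (U : set X) : open U = down_closed U.
Proof. by []. Qed.

Lemma inc_le_refl (x : X) : inc_le x x.
Proof. by case: x => z /=. Qed.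

Lemma inc_le_trans (y x z : X) : inc_le x y -> inc_le y z -> inc_le x z.
Proof. by case: x y z => x [y|y] [z|z] //= => [/eqP->|/eqP->|+ /eqP<-|/eqP->]. Qed.

Lemma inc_le_anti (x y : X) : inc_le x y -> inc_le y x -> x = y.
Proof. by case: x y => x [y|y] //= /eqP->. Qed.

Lemma open_below (x : X) : open [set z | inc_le z x].
Proof. by rewrite openE_down => u v uv /= vx; exact: inc_le_trans vx. Qed.

Lemma finite_incidence : finite_set [set: X].
Proof. exact: (@finite_finset (P + T)%type). Qed.

Lemma space_le_inc (x y : X) : space_le x y <-> inc_le x y.
Proof.
split=> [/(space_leE finite_incidence) xy|xy].
  exact: (xy [set w | inc_le w y] (conj (@open_below y) (inc_le_refl y))).
by apply/(space_leE finite_incidence) => U [oU Uy]; exact: (oU x y xy Uy).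
Qed.

Lemma continuous_incP (f : X -> X) :
  continuous f <-> {homo f : x y / inc_le x y}.
Proof.
split=> [cf x y /space_le_inc xy|fh].
  by apply/space_le_inc; apply: continuous_space_le; first exact: finite_incidence.
apply/continuousP => U; rewrite !openE_down => dU x y xy Uy.
exact: (dU (f x) (f y) (fh _ _ xy)).
Qed.

Lemma kolmogorov_incidence : kolmogorov_space X.
Proof.
move=> x y xy.
have ndown z : nbhs z [set w | inc_le w z].
  by apply: open_nbhs_nbhs; split; [exact: open_below | exact: inc_le_refl].
have [le_xy|nle_xy] := boolP (inc_le x y).
  exists [set w | inc_le w x]; left; split; first exact/mem_set/ndown.
  by apply/mem_set => /= le_yx; case/eqP: xy; exact: inc_le_anti.
exists [set w | inc_le w y]; right; split; first exact/mem_set/ndown.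
by apply/mem_set; apply/negP.
Qed.

(** A clopen set is closed under passing up and down, and everything is joined
    to the block [w]. *)
Lemma connected_incidence (w : T) :
  (forall p, inc p w) -> (forall t, exists p, inc p t) -> connected [set: X].
Proof.
move=> pw tp B [b Bb] [U oU BU] [V cV BV].
rewrite setTI in BU; rewrite setTI in BV; rewrite -BU in oU; rewrite -BV in cV.
have dC : down_closed (~` B) by exact: (closed_openC cV).
have up x y : inc_le x y -> B x -> B y.
  by move=> xy Bx; apply: contrapT => nBy; exact: (dC _ _ xy nBy).
have Bw : B (inr w).
  case: b Bb => [p|t] Bb; first exact: (up (inl p) (inr w) (pw p) Bb).
  have [p pt] := tp t; apply: (up (inl p) (inr w) (pw p)).
  exact: (oU (inl p) (inr t) pt).
apply/seteqP; split=> // -[p|t] _; first exact: (oU (inl p) (inr w) (pw p) Bw).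
have [p pt] := tp t; apply: (up (inl p) (inr t) pt).
exact: (oU (inl p) (inr w) (pw p) Bw).
Qed.

Definition is_block (x : X) : bool := if x is inr _ then true else false.

Lemma height_incidence (p0 : P) (t0 : T) : inc p0 t0 -> height X = 1%N.
Proof.
move=> pt0; rewrite /height.
set m := (X in X.-1); suff -> : m = 2%N by [].
have inX (x : X) : x \in fset_set [set: X].
  by rewrite in_fset_set; [exact: mem_set | exact: finite_incidence].
apply/eqP; rewrite eqn_leq; apply/andP; split.
  apply/bigmax_leqP_seq => C _ /asboolP chC.
  (* A chain contains at most one point and at most one block. *)
  have inj : {in C &, injective is_block}.
    move=> x y Cx Cy exy; have := chC x y Cx Cy.
    by case: x y exy {Cx Cy} => x [y|y] //= _ [] /space_le_inc /= /eqP ->.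
  rewrite -(card_in_imfset imfset_key inj) /=.
  apply: (@leq_trans #|` [fset true; false]%fset|); last by rewrite cardfs2.
  by apply: fsubset_leq_card; apply/fsubsetP => -[] _; rewrite !inE.
pose C : {fset X} := [fset (inl p0 : X); (inr t0 : X)]%fset.
have cC : #|` C| = 2%N by rewrite cardfs2.
rewrite -cC; apply: (@leq_bigmax_seq _ _ _ (fun C : {fset X} => #|` C|)).
  by rewrite fpowersetE; apply/fsubsetP => x _; exact: inX.
apply/asboolP => x y /=; rewrite !inE.
by case/orP=> /eqP-> /orP[]/eqP->; rewrite !space_le_inc /= ?eqxx ?pt0; auto.
Qed.

(** A map below the identity fixes the minimal elements. If it sent a block to
    a point [p], then any other point [q] of this block would be sent below
    [p], although it is fixed. Dually for a map above the identity. *)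
Lemma rigid_incidence :
  (forall t p, exists2 q, q != p & inc q t) ->
  (forall p t, exists2 u, u != t & inc p u) ->
  rigid_space X.
Proof.
move=> two_points two_blocks f /continuous_incP fh [fle|fge]; apply/funext.
  have {}fle x : inc_le (f x) x by exact/space_le_inc.
  have fp p : f (inl p) = inl p by have := fle (inl p); case: (f _) => //= q /eqP->.
  case=> [//|t]; have := fle (inr t).
  case ft : (f (inr t)) => [p|u] //=; last by move/eqP->.
  have [q qp qt] := two_points t p.
  have := fh (inl q) (inr t) qt; rewrite fp ft /= => /eqP eqp.
  by rewrite eqp eqxx in qp.
have {}fge x : inc_le x (f x) by exact/space_le_inc.
have ft t : f (inr t) = inr t by have := fge (inr t); case: (f _) => //= q /eqP->.
case=> [p|//]; have := fge (inl p).
case fp : (f (inl p)) => [q|t] //=; first by move/eqP->.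
have [u ut pu] := two_blocks p t.
have := fh (inl p) (inr u) pu; rewrite ft fp /= => /eqP etu.
by rewrite etu eqxx in ut.
Qed.

(** * Automorphisms of an incidence structure *)

Definition inc_aut (a : P -> P) (b : T -> T) : Prop :=
  [/\ bijective a, bijective b & forall p t, inc (a p) (b t) = inc p t].

Definition inc_map (a : P -> P) (b : T -> T) (x : X) : X :=
  match x with inl p => inl (a p) | inr t => inr (b t) end.

Lemma homeomorphism_inc_map (a : P -> P) (b : T -> T) :
  inc_aut a b -> homeomorphism (inc_map a b).
Proof.
move=> [[a' aK a'K] [b' bK b'K] ab].
split; first by apply/continuous_incP => -[p|t] [q|u] //= ; rewrite ?ab // => /eqP->.
exists (inc_map a' b'); split; try by case=> x /=; congr (_ _).
apply/continuous_incP => -[p|t] [q|u] //=; try by move/eqP->.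
by rewrite -(ab (a' p)) a'K b'K.
Qed.

(** Points are told from blocks by the order, because each point lies strictly
    below some block and each block strictly above some point. *)
Lemma homeomorphism_inc_aut (f : X -> X) :
  (forall p, exists t, inc p t) -> (forall t, exists p, inc p t) ->
  homeomorphism f -> exists a b, inc_aut a b /\ f = inc_map a b.
Proof.
move=> pt tp [/continuous_incP cf [g [/continuous_incP cg fK gK]]].
have preserve (h k : X -> X) : {homo h : x y / inc_le x y} ->
    {homo k : x y / inc_le x y} -> cancel h k ->
    (forall p, exists q, h (inl p) = inl q) /\
    (forall t, exists u, h (inr t) = inr u).
  move=> ch ck hK; split=> [p|t].
    have [t p_t] := pt p.
    have := ch (inl p) (inr t) p_t; case ep : (h (inl p)) => [q|u]; first by exists q.
    case et : (h (inr t)) => [//|v] /= /eqP uv.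
    by have := hK (inl p); rewrite ep uv -et hK.
  have [p p_t] := tp t.
  have := ch (inl p) (inr t) p_t; case et : (h (inr t)) => [q|u]; last by exists u.
  case ep : (h (inl p)) => [v|//] /= /eqP uv.
  by have := hK (inl p); rewrite ep uv -et hK.
have [fP fT] := preserve f g cf cg fK; have [gP gT] := preserve g f cg cf gK.
have [a ea] := choice fP; have [b eb] := choice fT.
have [a' ea'] := choice gP; have [b' eb'] := choice gT.
exists a, b; split; last by apply/funext => -[p|t] /=.
have aK : cancel a a' by move=> p; have := fK (inl p); rewrite ea ea' => -[].
have bK : cancel b b' by move=> p; have := fK (inr p); rewrite eb eb' => -[].
split; [exists a' => // p | exists b' => // t |].
- by have := gK (inl p); rewrite ea' ea => -[].
- by have := gK (inr t); rewrite eb' eb => -[].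
move=> p t; apply/idP/idP => h.
  by have := cg (inl (a p)) (inr (b t)) h; rewrite ea' eb' /= aK bK.
by have := cf (inl p) (inr t) h; rewrite ea eb.
Qed.

End IncidenceSpace.

(** * An incidence structure with a given automorphism group *)

Section GroupIncidence.
Variable G : finGroupType.
Local Notation n := #|G|.

(** The markers, and the two copies of [G]. *)
Definition point : finType := ('I_n.+1 + (G + G))%type.
(** The blocks [S_j], then the blocks [T_(g,i)]; the boolean distinguishes [W]
    from [A]. *)
Definition block : finType := ('I_n + G * 'I_n + bool)%type.

Definition Kpt (k : 'I_n.+1) : point := inl k.
Definition apt (g : G) : point := inr (inl g).
Definition bpt (g : G) : point := inr (inr g).
Definition Sblk (j : 'I_n) : block := inl (inl j).
Definition Tblk (g : G) (i : 'I_n) : block := inl (inr (g, i)).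
Definition Ablk : block := inr false.
Definition Wblk : block := inr true.

Definition cayley_inc (p : point) (t : block) : bool :=
  match t, p with
  | inl (inl j), inl k => k <= j.+1
  | inl (inl _), inr _ => false
  | inl (inr (_, i)), inl k => k != i.+1 :> nat
  | inl (inr (g, _)), inr (inl h) => h == g
  | inl (inr (g, i)), inr (inr h) => h == (g * enum_val i)%g
  | inr _, inl _ => true
  | inr _, inr (inl _) => true
  | inr w, inr (inr _) => w
  end.

Lemma card_gt0 : 0 < n.
Proof. by apply/card_gt0P; exists 1%g. Qed.

Definition first_idx : 'I_n := Ordinal card_gt0.
Definition last_idx : 'I_n := rev_ord first_idx.

Lemma Kpt_last (k : 'I_n.+1) : cayley_inc (Kpt k) (Sblk last_idx).
Proof. by have := ltn_ord k; have := card_gt0; rewrite /=; lia. Qed.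

(** The only marker outside [Tblk g i]. The shift leaves the marker [0] on all
    blocks, which distinguishes it from [1] in [aut_Kpt]. *)
Definition omitted (i : 'I_n) : 'I_n.+1 := lift ord0 i.

Definition block_size (t : block) : nat := #|[pred p | cayley_inc p t]|.

Lemma card_point (Q : pred point) :
  #|[pred p | Q p]| = #|[pred k | Q (Kpt k)]| + #|[pred g | Q (apt g)]|
                      + #|[pred g | Q (bpt g)]|.
Proof.
rewrite -sum1_card !big_sumType /= addnA.
by congr (_ + _ + _); rewrite -[RHS]sum1_card; apply: eq_bigl.
Qed.

Lemma block_size_S j : block_size (Sblk j) = j.+2.
Proof.
rewrite /block_size card_point !(@eq_card0 _ [pred g | false]) // !addn0.
rewrite -sum1_card /=.
have jn : j.+2 <= n.+1 by rewrite ltnS.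
by rewrite (big_ord_narrow jn) sum1_card card_ord.
Qed.

Lemma block_size_T g i : block_size (Tblk g i) = n.+2.
Proof.
rewrite /block_size card_point /= !card1 !addn1; congr _.+2.
rewrite (@eq_card _ _ [pred k | k != omitted i]).
  by rewrite cardC1 card_ord.
by [].
Qed.

Lemma block_size_A : block_size Ablk = n.+1 + n.
Proof.
rewrite /block_size card_point /= (@eq_card0 _ [pred g | false]) // addn0.
by rewrite card_ord.
Qed.

Lemma block_size_W : block_size Wblk = n.+1 + n + n.
Proof. by rewrite /block_size card_point /= card_ord. Qed.

Section Automorphism.
Variables (a : point -> point) (b : block -> block).
Hypothesis ab : inc_aut cayley_inc a b.

Let a_inj : injective a. Proof. by case: ab => /bij_inj. Qed.
Let b_inj : injective b. Proof. by case: ab => _ /bij_inj. Qed.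
Let abE p t : cayley_inc (a p) (b t) = cayley_inc p t.
Proof. by case: ab. Qed.

Lemma aut_block_size t : block_size (b t) = block_size t.
Proof.
case: ab => bij_a _ _; rewrite /block_size.
rewrite -[LHS](on_card_preimset (onW_bij _ bij_a)).
by apply: eq_card => p; rewrite !inE abE.
Qed.

(** The sizes [j.+2 <= n.+1] are pairwise distinct and smaller than those of all
    the other blocks. *)
Lemma aut_S j : b (Sblk j) = Sblk j.
Proof.
have := aut_block_size (Sblk j); have := ltn_ord j; have := card_gt0.
case: (b _) => [[j'|[g i]]|[]].
- by rewrite !block_size_S => _ _ [] /val_inj->.
- by rewrite block_size_T block_size_S; lia.
- by rewrite block_size_W block_size_S; lia.
- by rewrite block_size_A block_size_S; lia.
Qed.

Lemma aut_W : b Wblk = Wblk.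
Proof.
have := aut_block_size Wblk; have := card_gt0.
case: (b _) => [[j|[g i]]|[]] //; rewrite block_size_W.
- by have := ltn_ord j; rewrite block_size_S; lia.
- by rewrite block_size_T; lia.
- by rewrite block_size_A; lia.
Qed.

Lemma aut_Kpt_ex k : exists k', a (Kpt k) = Kpt k'.
Proof.
have := abE (Kpt k) (Sblk last_idx); rewrite aut_S Kpt_last.
by case: (a _) => // k' _; exists k'.
Qed.

Lemma aut_Kpt_surj k : exists k', a (Kpt k') = Kpt k.
Proof.
have [a' aK a'K] : bijective a by case: ab.
have := abE (a' (Kpt k)) (Sblk last_idx); rewrite aut_S a'K Kpt_last.
by case ek: (a' (Kpt k)) => [k'|] // _; exists k'; rewrite -[LHS]/(a (inl k')) -ek.
Qed.

(** The size does not suffice here: for [n = 1] it is that of [Tblk]. Instead,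
    the image of [Ablk] contains all markers, and [Tblk g i] omits one. *)
Lemma aut_A : b Ablk = Ablk.
Proof.
case eA: (b Ablk) => [[j|[g i]]|[]] //.
- by have := aut_S j; rewrite -[in RHS]/(Sblk j) -[Sblk j in RHS]eA => /b_inj.
- have [k ek] := aut_Kpt_surj (omitted i).
  by have := abE (Kpt k) Ablk; rewrite eA ek /= eqxx.
- by have := aut_W; rewrite -[Wblk in RHS]eA => /b_inj.
Qed.

Lemma aut_T_ex g i : exists g' i', b (Tblk g i) = Tblk g' i'.
Proof.
case eT: (b (Tblk g i)) => [[j|[g' i']]|[]].
- by have := aut_S j; rewrite -[Sblk j in RHS]eT => /b_inj.
- by exists g', i'.
- by have := aut_W; rewrite -[Wblk in RHS]eT => /b_inj.
- by have := aut_A; rewrite -[Ablk in RHS]eT => /b_inj.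
Qed.

(** The initial segments [Sblk j] have at least two markers, so they tell apart
    all markers but [0] and [1]; of these two, only [0] lies on all blocks. *)
Lemma aut_Kpt k : a (Kpt k) = Kpt k.
Proof.
have eq_or_small (l m : 'I_n.+1) : a (Kpt l) = Kpt m -> l = m \/ l <= 1 /\ m <= 1.
  move=> lm.
  have lmj (j : 'I_n) : (m <= j.+1) = (l <= j.+1).
    by have := abE (Kpt l) (Sblk j); rewrite lm aut_S.
  have below (u v : 'I_n.+1) : (forall j : 'I_n, (u <= j.+1) = (v <= j.+1)) ->
      1 < v -> u <= v.
    move=> uv v1; have v' : v.-1 < n by case: (nat_of_ord v) (ltn_ord v) v1.
    have := uv (Ordinal v'); rewrite /= prednK; last exact: ltnW.
    by rewrite leqnn => ->.
  have small (u v : 'I_n.+1) : (forall j : 'I_n, (u <= j.+1) = (v <= j.+1)) ->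
      v <= 1 -> u <= 1.
    by move=> uv v1; have := uv first_idx => /= ->.
  have [l1|l1] := leqP l 1; first by right; split=> //; exact: small l1.
  left; apply/val_inj/eqP; rewrite eqn_leq /=.
  have [m1|m1] := leqP m 1; last first.
    by rewrite (below _ _ lmj l1) andbT; exact: below m1.
  by have := small l m (fun j => esym (lmj j)) m1; lia.
have a0 : a (Kpt ord0) = Kpt ord0.
  have [m em] := aut_Kpt_ex ord0.
  have [//|[_ m1]] := eq_or_small _ _ em; first by move=> {2}->.
  have [b' bK b'K] : bijective b by case: ab.
  have := abE (Kpt ord0) (b' (Tblk 1%g first_idx)).
  rewrite em b'K /=.
  have -> : cayley_inc (inl ord0) (b' (Tblk 1%g first_idx)).
    by case: (b' _) => [[|[]]|].
  move=> m_ne1; congr Kpt; apply: val_inj => /=.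
  by case: (nat_of_ord m) m1 m_ne1 => [|[|]].
have [m em] := aut_Kpt_ex k.
have [km|[k1 m1]] := eq_or_small _ _ em; first by rewrite em km.
have [k0|k0] := eqVneq k ord0; first by rewrite k0.
rewrite em.
have [m0|m0] := eqVneq m ord0.
  by move: em; rewrite m0 -a0 => /a_inj [] /eqP; rewrite (negPf k0).
congr Kpt; apply: val_inj => /=; move: k0 m0; rewrite -!val_eqE /=.
by case: (nat_of_ord k) (nat_of_ord m) k1 m1 => [|[|?]] [|[|?]].
Qed.

Lemma aut_apt_ex g : exists g', a (apt g) = apt g'.
Proof.
have := abE (apt g) (Sblk last_idx); have := abE (apt g) Ablk; rewrite aut_S aut_A.
case: (a _) => [k|[g'|//]] _; last by exists g'.
by rewrite (Kpt_last k).
Qed.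

Lemma aut_bpt_ex g : exists g', a (bpt g) = bpt g'.
Proof.
have := abE (bpt g) Ablk; rewrite aut_A.
by case: (a _) => [k|[g'|g']] // _; exists g'.
Qed.

(** The image of [Tblk g i] is some [Tblk h i']; the point [apt g] yields
    [h = g'], and the omitted marker, being fixed, yields [i' = i]. *)
Lemma aut_T g i g' : a (apt g) = apt g' ->
  b (Tblk g i) = Tblk g' i /\
  a (bpt (g * enum_val i)%g) = bpt (g' * enum_val i)%g.
Proof.
move=> eg; have [h [i' eT]] := aut_T_ex g i.
have := abE (apt g) (Tblk g i); rewrite eg eT /= eqxx => /eqP gh.
have := abE (Kpt (omitted i')) (Tblk g i); rewrite aut_Kpt eT /= eqxx.
move/esym/negbFE/eqP => [] /val_inj ii; rewrite -{h}gh {i'}ii in eT *.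
split=> //; have [h eh] := aut_bpt_ex (g * enum_val i).
by have := abE (bpt (g * enum_val i)) (Tblk g i); rewrite eh eT /= eqxx => /eqP->.
Qed.

(** Taking [g = 1] in [aut_T] shows that the second copy of [G] is translated by
    [x], where [x] is the image of [1] in the first copy; taking [v = 1] shows
    that the first copy moves as the second does. *)
Lemma aut_translation : exists x : G,
  (forall g, a (apt g) = apt (x * g)%g) /\ (forall g, a (bpt g) = bpt (x * g)%g).
Proof.
have [x ex] := aut_apt_ex 1%g; exists x.
have eb g : a (bpt g) = bpt (x * g)%g.
  have [_] := aut_T (enum_rank g) ex.
  by rewrite enum_rankK mul1g.
split=> // g; have [h eh] := aut_apt_ex g.
have [_] := aut_T (enum_rank 1%g) eh.
by rewrite enum_rankK !mulg1 eb eh => -[->].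
Qed.

End Automorphism.

Definition act_point (x : G) (p : point) : point :=
  match p with
  | inl k => Kpt k
  | inr (inl g) => apt (x * g)
  | inr (inr g) => bpt (x * g)
  end.

Definition act_block (x : G) (t : block) : block :=
  match t with
  | inl (inr (g, i)) => Tblk (x * g) i
  | _ => t
  end.

Lemma act_pointM x y p : act_point (x * y) p = act_point x (act_point y p).
Proof. by case: p => [//|[g|g]] /=; rewrite mulgA. Qed.

Lemma act_blockM x y t : act_block (x * y) t = act_block x (act_block y t).
Proof. by case: t => [[//|[g i]]|//] /=; rewrite mulgA. Qed.

Lemma act_point1 p : act_point 1 p = p.
Proof. by case: p => [//|[g|g]] /=; rewrite mul1g. Qed.

Lemma act_block1 t : act_block 1 t = t.
Proof. by case: t => [[//|[g i]]|//] /=; rewrite mul1g. Qed.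

Lemma act_aut x : inc_aut cayley_inc (act_point x) (act_block x).
Proof.
split.
- by exists (act_point x^-1) => p; rewrite -act_pointM ?mulVg ?mulgV act_point1.
- by exists (act_block x^-1) => t; rewrite -act_blockM ?mulVg ?mulgV act_block1.
case=> [k|[h|h]] [[j|[g i]]|w] //=; first exact: (inj_eq (mulgI x)).
by rewrite -mulgA (inj_eq (mulgI x)).
Qed.

Lemma cayley_inc_aut a b : inc_aut cayley_inc a b ->
  exists x, a =1 act_point x /\ b =1 act_block x.
Proof.
move=> ab; have [x [ea eb]] := aut_translation ab; exists x; split.
  by case=> [k|[g|g]] /=; [exact: aut_Kpt ab k | exact: ea | exact: eb].
case=> [[j|[g i]]|[]] /=.
- exact: aut_S ab j.
- by have [] := aut_T ab i (ea g).
- exact: aut_W ab.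
- exact: aut_A ab.
Qed.

Local Notation X := (incidence_space cayley_inc).

Definition translation (x : G) : homeoAut X :=
  mkhomeoAut (homeomorphism_inc_map (act_aut x)).

Lemma translationM : {morph translation : x y / (x * y)%g}.
Proof.
move=> x y; apply: homeoAut_inj; apply/funext => -[p|t] /=.
  by congr inl; exact: act_pointM.
by congr inr; exact: act_blockM.
Qed.

Lemma two_points t p : exists2 q, q != p & cayley_inc q t.
Proof.
suff [q [r [qr qt rt]]] :
    exists q r, [/\ q != r, cayley_inc q t & cayley_inc r t].
  by have [qp|] := eqVneq q p; [exists r; rewrite // -qp eq_sym | exists q].
case: t => [[j|[g i]]|w].
- by exists (Kpt ord0), (Kpt (omitted first_idx)).
- by exists (Kpt ord0), (apt g); split=> //=.
- by exists (Kpt ord0), (Kpt (omitted first_idx)).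
Qed.

Lemma two_blocks p t : exists2 u, u != t & cayley_inc p u.
Proof.
suff [q [r [qr qt rt]]] :
    exists u v, [/\ u != v, cayley_inc p u & cayley_inc p v].
  by have [qp|] := eqVneq q t; [exists r; rewrite // -qp eq_sym | exists q].
case: p => [k|[g|g]].
- by exists Ablk, Wblk.
- by exists Ablk, Wblk.
- by exists Wblk, (Tblk g (enum_rank 1%g)); split=> //=; rewrite enum_rankK mulg1.
Qed.

Lemma translation_bij : bijective translation.
Proof.
apply: inj_surj_bijective => [x y|f].
  move=> /(congr1 (fun f : homeoAut X => homeoAut_fun f (inl (apt 1%g)))) /= [].
  by rewrite !mulg1.
have [a [b [ab ef]]] :
    exists a b, inc_aut cayley_inc a b /\ homeoAut_fun f = inc_map a b.
  apply: homeomorphism_inc_aut (homeoAut_funP f) => [p|t].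
    by have [u _ pu] := two_blocks p Wblk; exists u.
  by have [q _ qt] := two_points t (apt 1%g); exists q.
have [x [ea eb]] := cayley_inc_aut ab; exists x; apply: homeoAut_inj.
by rewrite ef; apply/funext => -[p|t] /=; rewrite ?ea ?eb.
Qed.

End GroupIncidence.

Theorem corollary3p2 (R : realType) (G : finGroupType) (n : nat)
    (hn : #|[set: G]%SET| = n) :
  exists X : topologicalType,
    [/\ finite_set (@setT X), kolmogorov_space X, connected (@setT X),
        height X = 1%N
      & group_isomorphic (homeoAut X) (hequivClass R X)
        /\ group_isomorphic (hequivClass R X) G].
Proof.
pose X := incidence_space (@cayley_inc G).
have finX : finite_set [set: X] by exact: finite_incidence.
have AutE : group_isomorphic (homeoAut X) (hequivClass R X).
  apply: homeoAut_iso_hequivClass finX _.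
  by apply: rigid_incidence; [exact: two_points | exact: two_blocks].
exists X; split=> //.
- exact: kolmogorov_incidence.
- apply: (@connected_incidence _ _ _ (Wblk G)); first by case=> [k|[g|g]].
  by move=> t; have [q _ qt] := two_points t (apt 1%g); exists q.
- exact: (@height_incidence _ _ _ (apt 1%g) (Wblk G)).
split=> //; apply: group_isomorphic_sym; apply: group_isomorphic_trans AutE.
exact: group_isomorphic_bij (@translationM G) (@translation_bij G).
Qed.
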